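(* Let $R$ be a commutative nonsingular ring which is not a V-ring (and is not von Neumann regular). The following are equivalent. (1) Every simple $R$-module is indigent or injective. (2) Every singular $R$-module is indigent or injective.
   Context: Rings are associative with identity. A module $M$ is called $N$-subinjective if for every module $K$ containing $N$ as a submodule, every homomorphism $N\to M$ extends to a homomorphism $K\to M$. The subinjectivity domain of $M$ is $\underline{\mathfrak{In}}^{-1}(M)=\{N : M \text{ is } N\text{-subinjective}\}$. A module $M$ is indigent if $\underline{\mathfrak{In}}^{-1}(M)$ is exactly the class of injective modules. A commutative ring $R$ is a V-ring if all simple $R$-modules are injective. *)

(* Defs.v *)
From HB Require Import structures.
From mathcomp Require Import all_boot all_algebra.

Set Implicit Arguments.
Unset Strict Implicit.
Unset Printing Implicit Defensive.

Import GRing.Theory.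
Local Open Scope ring_scope.

(* Submodules are boolean predicates closed under the module operations; under
   the classical axioms every subset of a module is such a predicate, so these
   are all the submodules. [R^o] is R as a module over itself, hence the
   submodules of [R^o] are the ideals of R when R is commutative. *)

(* N is a submodule of K up to the embedding i. *)
Definition subinjective (R : pzRingType) (N M : lmodType R) : Prop :=
  forall (K : lmodType R) (i : {linear N -> K}), injective i ->
  forall f : {linear N -> M}, exists g : {linear K -> M}, forall x, g (i x) = f x.

Definition injective_module (R : pzRingType) (E : lmodType R) : Prop :=
  forall (A B : lmodType R) (i : {linear A -> B}), injective i ->
  forall f : {linear A -> E}, exists g : {linear B -> E}, forall x, g (i x) = f x.

Definition subinjectivity_domain (R : pzRingType) (M : lmodType R)
    : lmodType R -> Prop :=
  fun N => subinjective N M.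

Definition indigent (R : pzRingType) (M : lmodType R) : Prop :=
  forall N : lmodType R, subinjectivity_domain M N <-> injective_module N.

Definition simple_module (R : pzRingType) (M : lmodType R) : Prop :=
  (exists x : M, x != 0) /\
  forall S : {pred M}, submod_closed S ->
    (forall x, x \in S -> x = 0) \/ (forall x, x \in S).

Definition essential_submodule (R : pzRingType) (M : lmodType R)
    (S : {pred M}) : Prop :=
  submod_closed S /\
  forall T : {pred M}, submod_closed T -> (exists2 x, x \in T & x != 0) ->
    exists x, [/\ x \in S, x \in T & x != 0].

Definition annihilator (R : pzRingType) (M : lmodType R) (m : M) : {pred R^o} :=
  [pred r : R^o | (r : R) *: m == 0].

(* Membership in the singular submodule Z(M). *)
Definition singular_element (R : pzRingType) (M : lmodType R) (m : M) : Prop :=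
  essential_submodule (annihilator m).

Definition singular_module (R : pzRingType) (M : lmodType R) : Prop :=
  forall m : M, singular_element m.

Definition nonsingular_module (R : pzRingType) (M : lmodType R) : Prop :=
  forall m : M, singular_element m -> m = 0.

Definition nonsingular_ring (R : comPzRingType) : Prop :=
  nonsingular_module (R^o : lmodType R).

Definition V_ring (R : comPzRingType) : Prop :=
  forall M : lmodType R, simple_module M -> injective_module M.

Definition von_neumann_regular (R : pzRingType) : Prop :=
  forall a : R, exists b : R, a = a * b * a.

(* Main.v *)
Require Import Defs.
From HB Require Import structures.
From mathcomp Require Import all_boot all_algebra.
From mathcomp Require Import boolp classical_sets functions.

Set Implicit Arguments.
Unset Strict Implicit.
Unset Printing Implicit Defensive.

Import GRing.Theory Num.Theory.
Local Open Scope ring_scope.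

(** A simple module over a commutative ring is either injective or singular
    ([simple_injective_or_singular]), so what holds for all singular modules
    holds for all simple ones.

    For the converse, the failure of the V-ring property gives a simple S that
    is not injective, hence indigent. Two facts about Hom into S drive the
    proof. If E is injective then Hom(E, S) = 0: a nonzero map E -> S lets every
    map R -> S factor through E, so S would be R-subinjective, R would be
    self-injective, and a self-injective commutative nonsingular ring is von
    Neumann regular. If Hom(X, S) = 0 then S is X-subinjective for trivial
    reasons, so X is injective. Injectivity of X is therefore the same as
    Hom(X, S) = 0, which makes every quotient of an injective module injective,
    and makes the trace t(M) of injective modules in M the largest injective
    submodule of M.

    Let M be singular and not injective; then t(M) is not M. Suppose that some y
    outside t(M) is killed by the annihilator m of a generator of S. Then M is
    indigent: if N is not injective, a nonzero N -> S followed by S = Ry in M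
    cannot extend to an injective module containing N, because its image would
    lie in t(M).

    To find y, take x outside t(M) and I = {r | rx in t(M)}, an essential ideal.
    Failure at all multiples of x modulo t(M) means that mr <= I forces r in I.
    If I is not inside m, then Rx + t(M) has no map onto S, so x is in t(M).
    If I is inside m, then I = mI ([hereditary_dual_basis] supplies the inverse
    ideal of m that this needs), so I has no map onto S, is injective, is a
    direct summand of R, and equals R ([injective_essential_ideal]); again x is
    in t(M). Finally y is corrected by an element of t(M), using that t(M) is
    injective.

    The supporting theory is that every module embeds in an injective one
    ([enough_injectives]), through Baer's criterion, divisible groups and
    coinduction along Z -> R. *)
(** * Submodules and quotient modules *)

Definition submodule_prop (R : pzRingType) (M : lmodType R) (P : M -> Prop) :=
  P 0 /\ forall a x y, P x -> P y -> P (a *: x + y).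

Definition mk_linear (R : pzRingType) (U V : lmodType R) (f : U -> V)
    (lin_f : linear f) : {linear U -> V} :=
  HB.pack f (GRing.isLinear.Build R U V *:%R f lin_f).

Lemma submodule_prop_closed (R : pzRingType) (M : lmodType R) (P : M -> Prop) :
  submodule_prop P -> GRing.submod_closed [pred x | `[< P x >]].
Proof.
case=> P0 PD; split=> [|a x y]; first exact/asboolP.
by move=> /asboolP Px /asboolP Py; apply/asboolP; exact: PD.
Qed.

Section SubmoduleType.
Variables (R : pzRingType) (M : lmodType R) (S : {pred M}).
Hypothesis hS : GRing.submod_closed S.

Definition submodule_type of GRing.submod_closed S := {x : M | x \in S}.
HB.instance Definition _ := SubChoice.on (submodule_type hS).
HB.instance Definition _ :=
  GRing.SubChoice_isSubLmodule.Build R M _ (submodule_type hS)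
    (GRing.submod_closed_semi hS).

Definition submodule_inj : {linear submodule_type hS -> M} := val.

End SubmoduleType.

(** Submodules and quotients are used only through a map from or to some module,
    which keeps their concrete carriers out of the later statements. *)
Lemma submodule_exists (R : pzRingType) (M : lmodType R) (P : M -> Prop) :
  submodule_prop P ->
  exists (X : lmodType R) (j : {linear X -> M}),
    [/\ injective j, forall z, P (j z) & forall x, P x -> exists z, j z = x].
Proof.
move=> /submodule_prop_closed hP.
exists (submodule_type hP), (submodule_inj hP); split=> [|[x Px]|x Px].
- exact: val_inj.
- exact/asboolP.
- by exists (exist _ x (asboolT Px)).
Qed.

Section QuotientModule.
Local Open Scope quotient_scope.
Variables (R : pzRingType) (M : lmodType R) (S : {pred M}).
Hypothesis hS : GRing.submod_closed S.

Definition submodule_zmodClosed : zmodClosed M :=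
  HB.pack S (GRing.isZmodClosed.Build M S (GRing.submod_closedB hS)).

Definition quotient_module := Quotient.quot submodule_zmodClosed.
HB.instance Definition _ := GRing.Zmodule.on quotient_module.

Let Q := quotient_module.
Definition quotient_pi (x : M) : Q := \pi_(Quotient.quot submodule_zmodClosed) x.

Lemma quotient_piE x y : (quotient_pi x = quotient_pi y) <-> (x - y \in S).
Proof.
rewrite /quotient_pi.
have -> : (x - y \in S) = (x - y \in submodule_zmodClosed) by [].
by rewrite Quotient.idealrBE; split=> /eqP.
Qed.

Lemma quotient_piD x y : quotient_pi (x + y) = quotient_pi x + quotient_pi y.
Proof. by rewrite /quotient_pi Quotient.pi_add. Qed.

Lemma quotient_pi_surj q : exists x, quotient_pi x = q.
Proof. by exists (repr q); rewrite /quotient_pi; exact: reprK. Qed.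

Definition quotient_scale (a : R) (q : Q) : Q :=
  quotient_pi (a *: repr (q : Quotient.quot submodule_zmodClosed)).

Lemma quotient_scaleE a x : quotient_scale a (quotient_pi x) = quotient_pi (a *: x).
Proof.
apply/quotient_piE; rewrite -scalerBr; set y := _ - _.
have yS : y \in S by apply/quotient_piE; exact: reprK.
by have := hS.2 a y 0 yS hS.1; rewrite addr0.
Qed.

Lemma quotient_scalerA a b q :
  quotient_scale a (quotient_scale b q) = quotient_scale (a * b) q.
Proof.
by have [x <-] := quotient_pi_surj q; rewrite !quotient_scaleE scalerA.
Qed.
Lemma quotient_scale1r : left_id 1 quotient_scale.
Proof.
by move=> q; have [x <-] := quotient_pi_surj q; rewrite quotient_scaleE scale1r.
Qed.
Lemma quotient_scalerDr : right_distributive quotient_scale +%R.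
Proof.
move=> a p q; have [x <-] := quotient_pi_surj p; have [y <-] := quotient_pi_surj q.
by rewrite -quotient_piD !quotient_scaleE scalerDr quotient_piD.
Qed.
Lemma quotient_scalerDl q : {morph quotient_scale^~ q : a b / a + b}.
Proof.
move=> a b; have [x <-] := quotient_pi_surj q.
by rewrite !quotient_scaleE scalerDl quotient_piD.
Qed.

HB.instance Definition _ := GRing.Zmodule_isLmodule.Build R quotient_module
  quotient_scalerA quotient_scale1r quotient_scalerDr quotient_scalerDl.

Lemma quotient_pi_linear : linear quotient_pi.
Proof. by move=> a x y; rewrite quotient_piD -quotient_scaleE. Qed.

End QuotientModule.

Lemma quotient_exists (R : pzRingType) (M : lmodType R) (P : M -> Prop) :
  submodule_prop P ->
  exists (Q : lmodType R) (p : {linear M -> Q}),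
    (forall q, exists x, p x = q) /\ (forall x, p x = 0 <-> P x).
Proof.
move=> /submodule_prop_closed hP; exists (quotient_module hP).
exists (mk_linear (quotient_pi_linear hP)); split=> [q|x].
  exact: quotient_pi_surj.
rewrite -(raddf0 (mk_linear (quotient_pi_linear hP))).
split=> [/quotient_piE|Px]; first by rewrite subr0 => /asboolP.
by apply/quotient_piE; rewrite subr0; apply/asboolP.
Qed.

(** * Baer's criterion *)

(** The graph of a linear map from a submodule of B to E; the last clause makes
    it single-valued. Graphs can be united along chains, and the domain need not
    be turned into a module of its own. *)
Definition partial_linear (R : pzRingType) (B E : lmodType R)
    (G : B -> E -> Prop) :=
  [/\ G 0 0,
      forall a x y x' y', G x y -> G x' y' -> G (a *: x + x') (a *: y + y')
    & forall y, G 0 y -> y = 0].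

Lemma partial_linear_uniq (R : pzRingType) (B E : lmodType R)
    (G : B -> E -> Prop) : partial_linear G ->
  forall b y y', G b y -> G b y' -> y = y'.
Proof.
case=> _ GD Gu b y y' Gy Gy'; apply/eqP; rewrite eq_sym -subr_eq0; apply/eqP/Gu.
by have := GD (-1) _ _ _ _ Gy Gy'; rewrite !scaleN1r addNr addrC.
Qed.

Lemma partial_linear_total (R : pzRingType) (B E : lmodType R)
    (G : B -> E -> Prop) : partial_linear G -> (forall b, exists y, G b y) ->
  exists g : {linear B -> E}, forall b, G b (g b).
Proof.
move=> Gp Gt; have [g Gg] := choice Gt.
have g_lin : linear g.
  move=> a x y; apply: (partial_linear_uniq Gp (Gg _)).
  by case: Gp => _ GD _; exact: GD.
by exists (mk_linear g_lin).
Qed.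

(** The graph is itself a module: its first projection is a monomorphism into B
    and its second projection is the map to extend. *)
Lemma injective_module_extend (R : pzRingType) (E : lmodType R) :
  injective_module E -> forall (B : lmodType R) (G : B -> E -> Prop),
  partial_linear G ->
  exists g : {linear B -> E}, forall b y, G b y -> g b = y.
Proof.
move=> injE B G [G0 GD Gu].
have [|X [j [j_inj Gj jG]]] :=
  @submodule_exists R (B * E)%type (fun z => G z.1 z.2).
  by split=> // a [x y] [x' y']; exact: GD.
have f1 : linear (fun x => (j x).1) by move=> a x y; rewrite linearP.
have f2 : linear (fun x => (j x).2) by move=> a x y; rewrite linearP.
have inj1 : injective (mk_linear f1).
  apply: raddf_inj => x /= x0; apply: j_inj; rewrite raddf0.
  have := Gj x; rewrite x0 => /Gu y0.
  by rewrite [j x]surjective_pairing x0 y0.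
have [g gE] := injE _ _ _ inj1 (mk_linear f2).
exists g => b y Gby; have [z jz] := jG (b, y) Gby.
by have := gE z; rewrite /= jz.
Qed.

(** Baer's criterion, by Zorn's lemma on graphs: if b is outside the domain of a
    maximal graph G, the map r |-> G (r b) on the ideal of those r with r b in
    the domain is multiplication by some e, and b |-> e extends G. *)
Lemma baer (R : pzRingType) (E : lmodType R) :
  (forall G : R^o -> E -> Prop, partial_linear G ->
     exists e : E, forall (r : R) y, G r y -> y = r *: e) ->
  injective_module E.
Proof.
move=> baerE A B i i_inj f.
pose G0 : set (B * E) := fun z => exists a, z = (i a, f a).
pose good (G : set (B * E)) :=
  partial_linear (fun b y => G (b, y)) /\ (G0 `<=` G)%classic.
(* The empty set is admitted because it is the union of the empty chain. *)
pose P (G : set (B * E)) := G = set0 \/ good G.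
have PN G z : P G -> G z -> good G by case=> // ->.
have goodG0 : good G0.
  split=> //; split=> [|a x y x' y'|y].
  - by exists 0; rewrite !raddf0.
  - by case=> u [-> ->] [u' [-> ->]]; exists (a *: u + u'); rewrite !linearP.
  - case=> u [/eqP]; rewrite eq_sym raddf_eq0 // => /eqP-> ->.
    by rewrite raddf0.
have [F FP Ftot|G [PG Gmax]] := @Zorn_bigcup _ P.
  have [[X FX [z Xz]]|F0] := pselect (exists2 X, F X & (X !=set0)%classic); last first.
    left; apply/seteqP; split=> // z [X FX Xz]; case: F0.
    by exists X => //; exists z.
  have [[X0 _ _] G0X] := PN _ _ (FP _ FX) Xz.
  right; split=> [|w /G0X ?]; last by exists X.
  split; first by exists X.
  - move=> a x y x' y' [Y FY Yx] [Y' FY' Yx'].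
    have [[_ YD _] _] := PN _ _ (FP _ FY) Yx.
    have [[_ YD' _] _] := PN _ _ (FP _ FY') Yx'.
    have [sYY'|sY'Y] := Ftot _ _ FY FY'.
      by exists Y' => //; apply: YD' => //; exact: sYY'.
    by exists Y => //; apply: YD => //; exact: sY'Y.
  - move=> y [Y FY Yy]; have [[_ _ Yu] _] := PN _ _ (FP _ FY) Yy.
    exact: Yu.
have {PG} [Gp G0G] : good G.
  case: PG => // G_empty; case: (Gmax G0); last by right.
  by rewrite G_empty; split=> // sub0; case: goodG0 => -[/sub0].
have [G00 GD Gu] := Gp.
suff Gt b : exists y, G (b, y).
  have [g Gg] := partial_linear_total Gp Gt.
  exists g => a; apply: (partial_linear_uniq Gp (Gg _)).
  by apply: G0G; exists a.
have [|e eE] := baerE (fun (r : R) y => G (r *: b, y)).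
  split; first by rewrite scale0r.
  - by move=> a x y x' y' Gx Gx'; rewrite scalerDl -scalerA; exact: GD.
  - by move=> y; rewrite scale0r; exact: Gu.
pose G' : set (B * E) :=
  fun z => exists x y r, G (x, y) /\ z = (x + r *: b, y + r *: e).
have GG' : (G `<=` G')%classic.
  by move=> [x y] Gxy; exists x, y, 0; rewrite !scale0r !addr0.
apply: contrapT => Nb; apply: (Gmax G'); last first.
  right; split=> [|z /G0G/GG' //]; split; first exact: GG'.
  - move=> a x y x' y' [u [v [r [Guv [-> ->]]]]] [u' [v' [r' [Guv' [-> ->]]]]].
    exists (a *: u + u'), (a *: v + v'), (a * r + r'); split; first exact: GD.
    by congr (_, _); rewrite scalerDr scalerDl -scalerA addrACA.
  - move=> y [u [v [r [Guv [/esym/eqP]]]]]; rewrite addrC addr_eq0 => /eqP rb ->.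
    rewrite -(eE r (- v)) ?subrr // rb.
    by have := GD (-1) _ _ _ _ Guv G00; rewrite !scaleN1r !addr0.
split=> // /(_ (b, e)) G'G; apply: Nb; exists e; apply: G'G.
by exists 0, 0, 1; rewrite !add0r !scale1r.
Qed.
(** * Presentations by formal combinations *)

Section FormalCombinations.
Variables (R : pzRingType) (K X : lmodType R) (iota : {linear R^o -> K}).

(** [formal_sum s] is the element of the free module on X given by the list s of
    weighted points, seen as a finitely supported K-valued function. *)
Definition formal_sum (s : seq (R * X)) : X -> K :=
  fun x => \sum_(p <- s | p.2 == x) iota p.1.

(** The image of the same element under the canonical map from the free module
    to X. *)
Definition value (s : seq (R * X)) : X := \sum_(p <- s) p.1 *: p.2.
Definition scale_comb (a : R) (s : seq (R * X)) := [seq (a * p.1, p.2) | p <- s].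

Lemma formal_sum_lin a s t :
  formal_sum (scale_comb a s ++ t) = a *: formal_sum s + formal_sum t.
Proof.
apply/funext => x; rewrite /formal_sum big_cat big_map /=.
congr (_ + _); rewrite -[RHS]/(a *: formal_sum s x) /formal_sum scaler_sumr.
by apply: eq_bigr => p _; rewrite -linearZ.
Qed.

Lemma value_lin a s t : value (scale_comb a s ++ t) = a *: value s + value t.
Proof.
rewrite /value big_cat big_map /= scaler_sumr; congr (_ + _).
by apply: eq_bigr => p _; rewrite scalerA.
Qed.

(** Collecting repeated points shows that the value depends only on the
    coefficient function. *)
Lemma value_regroup s (c : X -> R) :
  (forall x, c x = \sum_(p <- s | p.2 == x) p.1) ->
  value s = \sum_(x <- undup [seq p.2 | p <- s]) c x *: x.
Proof.
move=> cE; under eq_bigr do rewrite cE scaler_suml.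
rewrite (exchange_big_dep predT) //= /value big_seq [RHS]big_seq.
apply: eq_bigr => p ps; rewrite -big_filter.
have -> : [seq x <- undup [seq p0.2 | p0 <- s] | p.2 == x] = [:: p.2].
  rewrite (eq_filter (a2 := pred1 p.2)); last by move=> x /=; rewrite eq_sym.
  by rewrite filter_pred1_uniq ?undup_uniq // mem_undup map_f.
by rewrite big_seq1.
Qed.

Hypothesis iota_inj : injective iota.

(** Write X as F / L with F free. Then L <= F <= K^X, so X embeds in the
    quotient Q of K^X by L, and a function whose class lies in X is congruent
    modulo L to a point mass, hence lies in F. Being a quotient of a power of K,
    Q inherits divisibility from K, and also injectivity when quotients of
    injective modules are injective. *)
Lemma free_quotient_exists :
  exists (Q : lmodType R) (pi : {linear (X -> K) -> Q}) (j : {linear X -> Q}),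
    [/\ forall q, exists u, pi u = q, injective j
      & forall u x, pi u = j x -> exists2 s, u = formal_sum s & value s = x].
Proof.
have [|Q [pi [pi_surj pi0]]] := @quotient_exists R (X -> K)
    (fun u => exists2 s, u = formal_sum s & value s = 0).
  split; first by exists [::]; rewrite /value ?big_nil //; apply/funext => x;
    rewrite /formal_sum big_nil.
  move=> a u v [s -> s0] [t -> t0]; exists (scale_comb a s ++ t).
    by rewrite formal_sum_lin.
  by rewrite value_lin s0 t0 scaler0 addr0.
have piE s t : value s = value t -> pi (formal_sum s) = pi (formal_sum t).
  move=> st; apply/eqP; rewrite eq_sym -subr_eq0 -scaleN1r addrC -linearP.
  apply/eqP/pi0; exists (scale_comb (-1) s ++ t); first by rewrite formal_sum_lin.
  by rewrite value_lin st scaleN1r addNr.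
have v1 x : value [:: (1, x)] = x by rewrite /value big_seq1 scale1r.
have j_lin : linear (fun x => pi (formal_sum [:: (1, x)])).
  move=> a x y; rewrite -linearP -formal_sum_lin; apply: piE.
  by rewrite value_lin !v1.
exists Q, pi, (mk_linear j_lin).
have lift u x : pi u = mk_linear j_lin x ->
    exists2 s, u = formal_sum s & value s = x.
  move=> /= /eqP; rewrite -subr_eq0 -linearB => /eqP/pi0[s us s0].
  exists (scale_comb 1 s ++ [:: (1, x)]).
    by rewrite formal_sum_lin -us scale1r subrK.
  by rewrite value_lin s0 scaler0 add0r v1.
split=> //; apply: raddf_inj => x x0.
have [|s s0 <-] := lift 0 x; first by rewrite x0 raddf0.
rewrite (@value_regroup s (fun=> 0)) => [|y].
  by rewrite big1 // => y _; rewrite scale0r.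
apply: iota_inj; rewrite raddf0 raddf_sum.
by rewrite -[LHS]/((0 : X -> K) y) s0.
Qed.

End FormalCombinations.

(** * Enough injectives *)
Lemma divisible_injective (D : lmodType int) :
  (forall (n : int) (d : D), n != 0 -> exists d', d = n *: d') ->
  injective_module D.
Proof.
move=> divD; apply: baer => G Gp; have [G00 GD Gu] := Gp.
pose P n := `[< exists y, G (n.+1 : int) y >].
have [[n Pn]|N] := pselect (exists n, P n); last first.
  exists 0 => r y; rewrite scaler0; case: (intP r) => [|n|n] Gry.
  - exact: Gu.
  - by case: N; exists n; apply/asboolP; exists y.
  - case: N; exists n; apply/asboolP; exists (- y).
    have := GD (-1) _ _ _ _ Gry G00.
    by rewrite !scaleN1r !addr0 opprK.
(* The ideal on which the graph is defined is generated by m + 1. *)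
case: (ex_minnP (ex_intro P n Pn)) => {Pn} m /asboolP[d Gd] m_min.
have [e de] := divD m.+1 d isT; exists e => r y Gry.
suff r0 : (r %% m.+1)%Z = 0.
  have rE : (r %/ m.+1)%Z * m.+1 = r by rewrite {2}(divz_eq r m.+1) r0 addr0.
  apply: (partial_linear_uniq Gp Gry).
  have := GD (r %/ m.+1)%Z _ _ _ _ Gd G00.
  by rewrite !addr0 -[_ *: (_ : int^o)]/(_ * _) rE de scalerA rE.
have Gr := GD (- (r %/ m.+1)%Z) _ _ _ _ Gd Gry.
have rE : - (r %/ m.+1)%Z *: (m.+1%:Z : int^o) + r = (r %% m.+1)%Z.
  by rewrite {2}(divz_eq r m.+1) -[_ *: _]/(_ * _) mulNr addKr.
rewrite rE in Gr; have r_ge0 : 0 <= (r %% m.+1)%Z by exact: modz_ge0.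
have r_lt := @ltz_pmod r m.+1 isT.
case: (r %% m.+1)%Z r_ge0 r_lt Gr => // -[//|k] _ k_lt Gr.
have := m_min k; rewrite /P leqNgt; have -> : (k < m)%N by [].
by move=> /(_ _)/negP[] //; apply/asboolP; exists (- (r %/ m.+1)%Z *: d + y).
Qed.

(** N = F / L with F free abelian embeds in a quotient of a power of the
    rationals, and quotients of divisible groups are divisible. *)
Lemma divisible_embedding (N : zmodType) :
  exists (D : lmodType int) (j : {linear zmodule N -> D}),
    injective_module D /\ injective j.
Proof.
have iota_lin : linear (fun n : int^o => (n%:~R : rat) : zmodule rat).
  move=> a x y; rewrite -[RHS]/((x%:~R *~ a + y%:~R) : rat) -(mulrzr _ a).
  by rewrite -[a *: x]/(a * x) intrD intrM mulrC.
have [|D [pi [j [pi_surj j_inj _]]]] :=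
  @free_quotient_exists int (zmodule rat) (zmodule N) (mk_linear iota_lin).
  exact: intr_inj.
exists D, j; split=> //; apply: divisible_injective => n d n0.
have [u <-] := pi_surj d; exists (pi (fun x => (u x : rat) / n%:~R)).
rewrite -linearZ; congr (pi _); apply/funext => x.
rewrite -[RHS]/(((u x : rat) / n%:~R) *~ n) -(mulrzr _ n).
by rewrite divfK // intr_eq0.
Qed.

Definition mk_additive (U V : zmodType) (f : U -> V) (fB : zmod_morphism f) :
  {additive U -> V} := HB.pack f (GRing.isZmodMorphism.Build U V f fB).

Lemma additive_int_linear (U V : lmodType int) (f : U -> V) :
  zmod_morphism f -> linear f.
Proof.
move=> fB a x y; rewrite -[a]intz !scaler_int.
by rewrite -[f]/(mk_additive fB : U -> V) raddfD raddfMz.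
Qed.

(** The coinduced module Hom_Z(R, D), with R acting on the argument. *)
Section Coinduced.
Variables (R : comPzRingType) (D : zmodType).

Definition coind_pred : pred (R -> D) := [pred f | `[< zmod_morphism f >]].
Definition coind := {f : R -> D | coind_pred f}.
HB.instance Definition _ := SubChoice.on coind.

Fact coind_zmod_closed : zmod_closed coind_pred.
Proof.
split=> [|f g /asboolP fB /asboolP gB]; apply/asboolP => x y.
  by rewrite /= subrr.
by rewrite -![(f - g) _]/(f _ - g _) fB gB !opprD [LHS]addrACA.
Qed.
HB.instance Definition _ :=
  GRing.SubChoice_isSubZmodule.Build (R -> D) _ coind coind_zmod_closed.

Lemma coindB (f : coind) x y : val f (x - y) = val f x - val f y.
Proof. by have /asboolP := valP f. Qed.

Fact coind_scale_subproof (a : R) (f : coind) :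
  coind_pred (fun x => val f (a * x)).
Proof. by apply/asboolP => x y; rewrite mulrBr coindB. Qed.
Definition coind_scale (a : R) (f : coind) : coind :=
  Sub _ (coind_scale_subproof a f).

Lemma coindP (f g : coind) : val f =1 val g -> f = g.
Proof. by move=> fg; apply/val_inj/funext. Qed.

Lemma coindD (f : coind) x y : val f (x + y) = val f x + val f y.
Proof. exact: (raddfD (mk_additive (coindB f))). Qed.

Fact coind_scalerA a b f : coind_scale a (coind_scale b f) = coind_scale (a * b) f.
Proof. by apply: coindP => x /=; rewrite mulrCA mulrA. Qed.
Fact coind_scale1r : left_id 1 coind_scale.
Proof. by move=> f; apply: coindP => x /=; rewrite mul1r. Qed.
Fact coind_scalerDr : right_distributive coind_scale +%R.
Proof. by move=> a f g; apply: coindP. Qed.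
Fact coind_scalerDl f : {morph coind_scale^~ f : a b / a + b}.
Proof. by move=> a b; apply: coindP => x /=; rewrite mulrDl coindD. Qed.
HB.instance Definition _ := GRing.Zmodule_isLmodule.Build R coind
  coind_scalerA coind_scale1r coind_scalerDr coind_scalerDl.

Lemma coind_exists (f : R -> D) : zmod_morphism f -> exists F : coind, val F =1 f.
Proof. by move=> /asboolP fB; exists (Sub f fB). Qed.

(** Half of the adjunction Hom_R(B, Hom_Z(R, D)) = Hom_Z(B, D). *)
Lemma coind_linear_exists (B : lmodType R) (g : B -> D) : zmod_morphism g ->
  exists G : {linear B -> coind}, forall b x, val (G b) x = g (x *: b).
Proof.
move=> gB; have gD x y : g (x + y) = g x + g y.
  exact: (raddfD (mk_additive gB)).
have Gex b : exists F : coind, val F =1 (fun x => g (x *: b)).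
  by apply: coind_exists => x y; rewrite scalerBl gB.
have [G GE] := choice Gex.
have G_lin : linear G.
  move=> a b c; apply: coindP => x; rewrite GE.
  rewrite -[RHS]/(val (G b) (a * x) + val (G c) x) !GE.
  by rewrite scalerDr gD scalerA mulrC.
by exists (mk_linear G_lin) => b x; rewrite -GE.
Qed.

End Coinduced.

(** Under the adjunction, extending an R-linear map into Hom_Z(R, D) amounts to
    extending an additive map into D. *)
Lemma coind_injective (R : comPzRingType) (D : lmodType int) :
  injective_module D -> injective_module (coind R D).
Proof.
move=> injD A B i i_inj f.
have [i_lin h_lin] : linear (i : zmodule A -> zmodule B) /\
    linear ((fun a => val (f a) 1) : zmodule A -> D).
  by split; apply: additive_int_linear => x y; rewrite raddfB.
have [g gE] := injD _ _ (mk_linear i_lin) i_inj (mk_linear h_lin).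
have [|G GE] := @coind_linear_exists R D B g; first by move=> x y; rewrite raddfB.
exists G => a; apply: coindP => x; rewrite GE -linearZ.
rewrite -[LHS]/(g (mk_linear i_lin (x *: a : A))) gE /= linearZ.
by rewrite -[LHS]/(val (f a) (x * 1)) mulr1.
Qed.

(** An embedding j of the additive group of N in a divisible group D gives
    n |-> (r |-> j (r n)), whose value at 1 recovers j. *)
Theorem enough_injectives (R : comPzRingType) (N : lmodType R) :
  exists (E : lmodType R) (i : {linear N -> E}), injective_module E /\ injective i.
Proof.
have [D [j [injD j_inj]]] := divisible_embedding N.
have [|i iE] := @coind_linear_exists R D N j; first by move=> x y; rewrite raddfB.
exists (coind R D), i; split; first exact: coind_injective.
move=> x y /(congr1 (fun f => val f 1)); rewrite !iE !scale1r; exact: j_inj.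
Qed.

(** * Injective and simple modules over commutative rings *)
Lemma fun_injective (R : pzRingType) (X : Type) (K : lmodType R) :
  injective_module K -> injective_module (X -> K).
Proof.
move=> injK A B i i_inj f.
have fx_lin x : linear (fun a => f a x) by move=> a u v; rewrite linearP.
have [g gE] := choice (fun x => injK _ _ _ i_inj (mk_linear (fx_lin x))).
have g_lin : linear (fun b x => g x b).
  by move=> a u v; apply/funext => x; rewrite linearP.
by exists (mk_linear g_lin) => a; apply/funext => x; rewrite /= gE.
Qed.

Lemma corestrict (R : pzRingType) (E X M : lmodType R) (j : {linear X -> M})
    (g : {linear E -> M}) : injective j -> (forall z, exists x, j x = g z) ->
  exists g' : {linear E -> X}, forall z, j (g' z) = g z.
Proof.
move=> j_inj; apply: (partial_linear_total (G := fun z x => j x = g z)).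
split; first by rewrite !raddf0.
- by move=> a z x z' x' jx jx'; rewrite !linearP jx jx'.
- by move=> x; rewrite raddf0 => jx; apply: j_inj; rewrite jx raddf0.
Qed.

Section SimpleModules.
Variables (R : comPzRingType) (S : lmodType R).
Hypothesis simpleS : simple_module S.
Variable s : S.
Hypothesis s_neq0 : s != 0.

Lemma simple_cyclic (x : S) : exists r : R, r *: s = x.
Proof.
have [|all0|allin] := simpleS.2 [pred y | `[< exists r : R, r *: s = y >]].
- apply: (@submodule_prop_closed _ _ (fun y => exists r : R, r *: s = y)).
  split=> [|a y z [r <-] [r' <-]]; first by exists 0; rewrite scale0r.
  by exists (a * r + r'); rewrite scalerDl scalerA.
- case/eqP: s_neq0; apply: all0; apply/asboolP.
  by exists 1; rewrite scale1r.
- by have /asboolP := allin x.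
Qed.

Lemma ann_simple (a : R) (x : S) : a *: s = 0 -> a *: x = 0.
Proof.
have [r <-] := simple_cyclic x.
by rewrite scalerA mulrC -scalerA => ->; rewrite scaler0.
Qed.

Lemma simple_lift (M : lmodType R) (y : M) :
  (forall a : R, a *: s = 0 -> a *: y = 0) ->
  exists psi : {linear S -> M}, psi s = y.
Proof.
move=> ys; pose G (x : S) (z : M) := exists r : R, x = r *: s /\ z = r *: y.
have Gp : partial_linear G.
  split; first by exists 0; rewrite !scale0r.
  - move=> a x z x' z' [r [-> ->]] [r' [-> ->]].
    by exists (a * r + r'); rewrite !scalerDl !scalerA.
  - by move=> z [r [/esym/ys r0 ->]].
have [|psi psiE] := partial_linear_total Gp.
  by move=> x; have [r <-] := simple_cyclic x; exists (r *: y), r.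
exists psi; apply: (partial_linear_uniq Gp (psiE s)).
by exists 1; rewrite !scale1r.
Qed.

End SimpleModules.

Lemma simple_torsionfree (R : comPzRingType) (S : lmodType R) (s x : S) (a : R) :
  simple_module S -> s != 0 -> a *: s != 0 -> a *: x = 0 -> x = 0.
Proof.
move=> simpleS s0 as0 ax; have [//|x0] := eqVneq x 0.
by case/eqP: as0; exact: (ann_simple simpleS x0).
Qed.

Lemma ann_submodule (R : comPzRingType) (M : lmodType R) (m : M) :
  submodule_prop (fun r : R^o => (r : R) *: m = 0).
Proof.
split=> [|a r r' r0 r'0]; first by rewrite scale0r.
by rewrite scalerDl -scalerA r0 r'0 scaler0 addr0.
Qed.

Lemma annihilator_closed (R : comPzRingType) (M : lmodType R) (m : M) :
  GRing.submod_closed (annihilator m).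
Proof.
have [P0 PD] := ann_submodule m.
split=> [|a r r' /eqP ? /eqP ?]; first exact/eqP.
by apply/eqP; exact: PD.
Qed.

(** If x^2 = 0 then the annihilator of x is essential: for t in a nonzero ideal,
    either t x = 0 or t x is itself a nonzero element killed by x. *)
Lemma nonsingular_reduced (R : comPzRingType) : nonsingular_ring R ->
  forall x : R, x * x = 0 -> x = 0.
Proof.
move=> nsR x xx; apply: (nsR (x : R^o)); split; first exact: annihilator_closed.
move=> T [T0 TD] [t Tt t0]; have [tx0|tx0] := eqVneq ((t : R) * x) 0.
  by exists t; split=> //; apply/eqP.
exists ((t : R) * x); split=> //; first by apply/eqP; rewrite -[LHS]mulrA xx mulr0.
by have := TD x t 0 Tt T0; rewrite addr0 -[x *: t]/(x * t) mulrC.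
Qed.

(** As R is reduced, a^2 and a have the same annihilator, so a^2 r |-> a r is
    well defined on the ideal generated by a^2. Self-injectivity makes it
    multiplication by some b, and then a^2 b = a. *)
Lemma reduced_injective_vnr (R : comPzRingType) :
  (forall x : R, x * x = 0 -> x = 0) ->
  injective_module (R^o : lmodType R) -> von_neumann_regular R.
Proof.
move=> redR injR a.
pose G (x y : R^o) := exists r : R, x = a * a * r /\ y = a * r.
have [|g gE] := @injective_module_extend R R^o injR R^o G.
  split; first by exists 0; rewrite !mulr0.
  - move=> c x y x' y' [r [-> ->]] [r' [-> ->]].
    exists (c * r + r'); rewrite -![c *: _]/(c * _) !mulrDr.
    by rewrite ![a * (c * _)]mulrCA -!mulrA ![a * (c * _)]mulrCA.
  - by move=> y [r [r0 ->]]; apply: redR; rewrite mulrACA mulrA -r0 mul0r.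
exists (g (1 : R^o)).
have : g (a * a) = a by apply: gE; exists 1; rewrite !mulr1.
have -> : (a * a : R) = (a * a : R) *: (1 : R^o) by rewrite -[RHS]/(_ * _) mulr1.
by rewrite linearZ => {1}<-; rewrite -[LHS]/(_ * _) mulrAC.
Qed.

(** Let s generate S. If the annihilator of s is not essential, a nonzero ideal
    T meets it trivially, and some e in T acts as the identity on S. A map f
    from an ideal I to S is then multiplication by an element of S: if c in I
    acts as the identity on S, then f (q) = c f (q) = q f (c); and if I kills S,
    then e I = 0 because it lies in T and kills s, so f (q) = f (e q) = 0. *)
Lemma simple_injective_or_singular (R : comPzRingType) (S : lmodType R) :
  simple_module S -> injective_module S \/ singular_module S.
Proof.
move=> simpleS; have [[s s0] _] := simpleS.
have [[_ ess]|Ness] := pselect (singular_element s).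
  right=> x; split=> [|T hT Tn0]; first exact: annihilator_closed.
  have [r [/eqP rs Tr r0]] := ess T hT Tn0; exists r; split=> //.
  by apply/eqP; exact: (ann_simple simpleS s0).
left; have [T [hT [t Tt t0] Tann]] : exists T : {pred R^o},
    [/\ GRing.submod_closed T, exists2 t, t \in T & t != 0
      & forall r, r \in T -> (r : R) *: s = 0 -> r = 0].
  apply: contrapT => NT; apply: Ness; split; first exact: annihilator_closed.
  move=> T hT Tn0; apply: contrapT => Nr; apply: NT; exists T; split=> // r Tr rs.
  apply/eqP; apply: contrapT => /negP r0; apply: Nr.
  by exists r; split=> //; apply/eqP.
have ts0 : (t : R) *: s != 0 by apply: contra_neq t0 => /(Tann t Tt).
have [r rts] := simple_cyclic simpleS ts0 s.
(* r * t lies in T and fixes s, hence fixes all of S. *)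
have [T0 TD] := hT.
have TM a u : u \in T -> (a : R) * u \in T.
  by move=> Tu; have := TD a u 0 Tu T0; rewrite addr0.
pose e : R := r * t; have es (x : S) : e *: x = x.
  have [c <-] := simple_cyclic simpleS s0 x.
  by rewrite scalerA mulrC -scalerA -(scalerA r) rts.
apply: baer => G Gp; have [G0 GD Gu] := Gp.
have GM a x y : G x y -> G ((a : R) * x) (a *: y).
  by move=> Gxy; have := GD a _ _ _ _ Gxy G0; rewrite !addr0.
have [[c [[y Gcy] cs]]|N] :=
  pselect (exists c : R, (exists y, G c y) /\ c *: s != 0).
  have [d dcs] := simple_cyclic simpleS cs s.
  have dcx (x : S) : (d * c) *: x = x.
    have [q <-] := simple_cyclic simpleS s0 x.
    by rewrite scalerA mulrC -scalerA -(scalerA d) dcs.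
  exists (d *: y) => q z Gqz; rewrite -(dcx z).
  apply: (partial_linear_uniq Gp (GM _ _ _ Gqz)).
  by rewrite mulrC -[_ * _]/(q * (d * c)); exact: GM (GM _ _ _ Gcy).
exists 0 => q z Gqz; rewrite scaler0 -(es z); apply: Gu.
have qs : q *: s = 0.
  apply/eqP; apply: contrapT => /negP qs; apply: N.
  by exists q; split=> //; exists z.
have <- : e * q = 0 :> R; last exact: GM.
apply: Tann; first by rewrite /e mulrAC; apply: TM.
by rewrite -scalerA qs scaler0.
Qed.

(** * Projective and injective ideals *)

(** Each x in J is the sum of the p.1 * p.2, and each p.1 has the form
    x * phi with phi in the inverse of J. This expresses that J is projective
    without a ring of fractions: multiplying p.1 by b in J gives x * d with
    d = phi b in R.

    Embed J in a quotient Q of K^J, where K is injective and contains R. Since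
    Q is injective, the embedding extends to R; let e in K^J lift the image of
    1. For each z in J, z e is a finitely supported R-valued function with value
    z, so that its coordinates z |-> z (e a) are the dual coordinates on J. *)
Lemma hereditary_dual_basis (R : comPzRingType) :
  (forall (E Q : lmodType R) (p : {linear E -> Q}), injective_module E ->
     (forall q, exists x, p x = q) -> injective_module Q) ->
  forall J : R^o -> Prop, submodule_prop J -> forall x : R, J x ->
  exists s : seq (R * R), x = \sum_(p <- s) p.1 * p.2 /\
    forall p, p \in s ->
      J p.2 /\ forall b : R, J b -> exists d : R, b * p.1 = x * d.
Proof.
move=> quot_inj J hJ x Jx.
have [K [iota [injK iota_inj]]] := enough_injectives (R^o : lmodType R).
have [X [k [k_inj Jk kJ]]] := submodule_exists hJ.
have [Q [pi [j [pi_surj j_inj lift]]]] := free_quotient_exists X iota_inj.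
have injQ : injective_module Q by apply: quot_inj pi_surj; exact: fun_injective.
have [h hE] := injQ _ _ k k_inj j.
have [e eE] := pi_surj (h (1 : R^o)).
have ke z : exists2 t, (k z : R) *: e = formal_sum iota t & value t = z.
  apply: lift; rewrite linearZ eE -linearZ -hE; congr (h _).
  by rewrite -[LHS]/((k z : R) * 1) mulr1.
have coef z u : exists c : R, iota c = (k z : R) *: e u.
  have [t kzt _] := ke z; exists (\sum_(p <- t | p.2 == u) p.1).
  by rewrite raddf_sum -[RHS]/(((k z : R) *: e) u) kzt.
have [z0 z0x] := kJ x Jx; have [t zt tz] := ke z0.
pose c u : R := \sum_(p <- t | p.2 == u) p.1.
have iota_c u : iota (c u) = x *: e u.
  by rewrite raddf_sum -z0x -[RHS]/(((k z0 : R) *: e) u) zt.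
exists [seq (c u, k u : R) | u <- undup [seq p.2 | p <- t]]; split=> [|p].
  rewrite big_map -[LHS]z0x -{1}tz (@value_regroup _ _ t c) // linear_sum.
  by apply: eq_bigr => u _; rewrite linearZ.
case/mapP=> u _ -> /=; split=> // b /kJ[w wb].
have [d dE] := coef w u; exists d; apply: iota_inj.
rewrite -[b * c u]/(b *: (c u : R^o)) -[x * d]/(x *: (d : R^o)).
by rewrite !linearZ /= iota_c dE wb !scalerA mulrC.
Qed.

(** An injective ideal is generated by an idempotent e, and an essential ideal
    cannot avoid the multiples of 1 - e unless e = 1. *)
Lemma injective_essential_ideal (R : comPzRingType) (P : R^o -> Prop)
    (X : lmodType R) (j : {linear X -> R^o}) :
  injective j -> (forall z, P (j z)) -> (forall r, P r -> exists z, j z = r) ->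
  submodule_prop P -> injective_module X ->
  (forall T : {pred R^o}, GRing.submod_closed T ->
     (exists2 r, r \in T & r != 0) -> exists r, [/\ P r, r \in T & r != 0]) ->
  P 1.
Proof.
move=> j_inj Pj jP hP injX ess.
have id_lin : linear (fun x : X => x) by [].
have [g gE] := injX _ _ j j_inj (mk_linear id_lin).
pose e : R := j (g (1 : R^o)).
have eE (r : R) : P r -> r * e = r.
  move=> /jP[z zr]; rewrite -[RHS]zr -(gE z : g (j z) = z) zr.
  have {2}-> : r = r *: (1 : R^o) by rewrite -[RHS]/(r * 1) mulr1.
  by rewrite !linearZ.
have Pe : P e by exact: Pj.
suff <- : e = 1 by [].
apply/eqP; rewrite eq_sym -subr_eq0; apply: contrapT => /negP f0.
have hT : submodule_prop (fun u : R^o => (u : R) * e = 0).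
  split=> [|a u v u0 v0]; first exact: mul0r.
  by rewrite mulrDl -[a *: u]/(a * u) -mulrA u0 v0 mulr0 addr0.
have [|r [Pr /asboolP re0 /eqP[]]] := ess _ (submodule_prop_closed hT).
  by exists (1 - e) => //; apply/asboolP; rewrite mulrBl mul1r eE // subrr.
by rewrite -(eE r Pr).
Qed.

(** * Rings with an indigent simple module *)
Section IndigentSimple.
Variables (R : comPzRingType) (S : lmodType R) (s : S).
Hypothesis redR : forall x : R, x * x = 0 -> x = 0.
Hypothesis NvnR : ~ von_neumann_regular R.
Hypothesis simpleS : simple_module S.
Hypothesis s_neq0 : s != 0.
Hypothesis indigentS : indigent S.

Definition no_hom (X : lmodType R) := forall (f : {linear X -> S}) x, f x = 0.

(** When Hom(X, S) = 0 the only map to extend is zero, so X is in the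
    subinjectivity domain of S. *)
Lemma no_hom_injective (X : lmodType R) : no_hom X -> injective_module X.
Proof.
move=> X0; apply: (proj1 (indigentS _)) => K i i_inj f.
have z_lin : linear (fun _ : K => 0 : S).
  by move=> a x y; rewrite scaler0 addr0.
by exists (mk_linear z_lin) => x; rewrite X0.
Qed.

(** Suppose f x <> 0. Every h : R -> S sends 1 to c (f x) for some c, so it
    factors as f after r |-> r c x, and the latter map R -> E extends to any
    overmodule of R. Thus S is R-subinjective, R is self-injective, and R is von
    Neumann regular. *)
Lemma injective_no_hom (E : lmodType R) : injective_module E -> no_hom E.
Proof.
move=> injE f x; apply: contrapT => /eqP fx0; apply: NvnR.
apply: reduced_injective_vnr => //; apply: (proj1 (indigentS _)) => K i i_inj h.
have [c cE] := simple_cyclic simpleS fx0 (h (1 : R^o)).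
have l_lin : linear (fun r : R^o => (r : R) *: (c *: x)).
  by move=> a u v; rewrite scalerDl -scalerA.
have [g gE] := injE _ _ i i_inj (mk_linear l_lin).
have fg_lin : linear (fun u => f (g u)) by move=> a u v; rewrite !linearP.
exists (mk_linear fg_lin) => r /=; rewrite gE /= !linearZ /= cE.
by rewrite -linearZ; congr (h _); rewrite -[LHS]/((r : R) * 1) mulr1.
Qed.

Lemma quotient_injective (E Q : lmodType R) (p : {linear E -> Q}) :
  injective_module E -> (forall q, exists x, p x = q) -> injective_module Q.
Proof.
move=> /injective_no_hom E0 p_surj; apply: no_hom_injective => f q.
have [x <-] := p_surj q.
have fp_lin : linear (fun u => f (p u)) by move=> a u v; rewrite !linearP.
exact: (E0 (mk_linear fp_lin)).
Qed.

(** The sum of the images in M of the modules X with Hom(X, S) = 0, equivalently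
    of the injective modules. Defining it through Hom makes closure under sums
    and extensions a matter of evaluating maps into S. *)
Definition trace (M : lmodType R) (x : M) : Prop :=
  exists (E : lmodType R) (g : {linear E -> M}) z, no_hom E /\ g z = x.

Lemma trace_submodule (M : lmodType R) : submodule_prop (@trace M).
Proof.
split=> [|a x y [E [g [z [E0 <-]]]] [E' [g' [z' [E'0 <-]]]]].
  have [E [i [injE _]]] := enough_injectives (R^o : lmodType R).
  have z_lin : linear (fun _ : E => 0 : M).
    by move=> a x y; rewrite scaler0 addr0.
  by exists E, (mk_linear z_lin), 0; split=> //; exact: injective_no_hom.
have h_lin : linear (fun w : E * E' => g w.1 + g' w.2).
  by move=> b u v; rewrite !linearP scalerDr addrACA.
exists (E * E')%type, (mk_linear h_lin), (a *: z, z'); split=> [f [u v]|].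
  have -> : (u, v) = (u, 0) + (0, v) by congr (_, _); rewrite ?addr0 ?add0r.
  have l1 : linear (fun u : E => f (u, 0)).
    move=> b w w'; rewrite -linearP; congr (f (_, _)).
    by rewrite /= scaler0 addr0.
  have l2 : linear (fun v : E' => f (0, v)).
    move=> b w w'; rewrite -linearP; congr (f (_, _)).
    by rewrite /= scaler0 addr0.
  rewrite linearD -[f (u, 0)]/(mk_linear l1 u) -[f (0, v)]/(mk_linear l2 v).
  by rewrite E0 E'0 addr0.
by rewrite /= linearZ.
Qed.

(** The trace is insensitive to passing to a submodule that contains it. *)
Lemma trace_image (X M : lmodType R) (j : {linear X -> M}) : injective j ->
  (forall x, trace x -> exists z, j z = x) ->
  forall z, trace (j z) -> trace z.
Proof.
move=> j_inj jt z [E [g [w [E0 gw]]]].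
have [g' g'E] : exists g' : {linear E -> X}, forall z, j (g' z) = g z.
  by apply: corestrict => // u; apply: jt; exists E, g, u.
by exists E, g', w; split=> //; apply: j_inj; rewrite g'E.
Qed.

Lemma hom_trace (X : lmodType R) (f : {linear X -> S}) x : trace x -> f x = 0.
Proof.
case=> E [g [z [E0 <-]]].
have fg_lin : linear (fun u => f (g u)) by move=> a u v; rewrite !linearP.
exact: (E0 (mk_linear fg_lin)).
Qed.

(** M / t(M) has a nonzero element killed by the annihilator m of s as soon as
    t(M) misses a singular x. Otherwise I = {r | r x in t(M)} contains every r
    with m r <= I. If some c in I is outside m, maps from R x + t(M) to S vanish:
    they vanish on t(M), and c moves x into t(M) while acting injectively on S.
    If I <= m, the dual basis of m writes w in I as a sum of products of elements
    of m with elements of I, so maps from I to S vanish, I is injective, and an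
    essential injective ideal is R. Both cases put x in t(M). *)
Lemma socle_mod_trace (M : lmodType R) (x : M) :
  singular_element x -> ~ trace x ->
  exists y : M, ~ trace y /\ forall b : R, b *: s = 0 -> trace (b *: y).
Proof.
move=> [_ x_sing] Nx; apply: contrapT => Ny.
have [t0 tD] := trace_submodule M.
pose I (r : R^o) := trace ((r : R) *: x).
have hI : submodule_prop I.
  split=> [|a r r' Ir Ir']; first by rewrite /I scale0r.
  by rewrite /I scalerDl -scalerA; exact: tD.
have satI (r : R) : (forall b : R, b *: s = 0 -> I (b * r)) -> I r.
  move=> bI; apply: contrapT => NI; apply: Ny; exists (r *: x); split=> // b bs.
  by rewrite scalerA; exact: bI.
have [[c [Ic cs]]|N] := pselect (exists c : R, I c /\ c *: s != 0).
  have [|X [j [j_inj Xj jX]]] := @submodule_exists R M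
      (fun u => exists (r : R) z, trace z /\ u = r *: x + z).
    split=> [|a u v [r [z [tz ->]]] [r' [z' [tz' ->]]]].
      by exists 0, 0; rewrite scale0r addr0.
    exists (a * r + r'), (a *: z + z'); split; first exact: tD.
    by rewrite scalerDr scalerDl -scalerA addrACA.
  apply: Nx; have [|w jw] := jX x.
    by exists 1, 0; rewrite scale1r addr0.
  exists X, j, w; split=> // f u; apply: (simple_torsionfree simpleS s_neq0 cs).
  rewrite -linearZ; apply: hom_trace; apply: (trace_image j_inj) => [v tv|].
    by apply: jX; exists 0, v; rewrite scale0r add0r.
  rewrite linearZ /=; have [r [z [tz ->]]] := Xj u.
  rewrite scalerDr scalerA mulrC -scalerA; apply: (tD r _ (c *: z)) => //.
  by rewrite -[_ *: z]addr0; exact: tD.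
have Is (r : R) : I r -> r *: s = 0.
  by move=> Ir; apply/eqP; apply: contrapT => /negP rs; apply: N; exists r.
have [X [j [j_inj Ij jI]]] := submodule_exists hI.
apply: Nx; rewrite -[x]scale1r.
apply: (injective_essential_ideal j_inj Ij jI hI); last first.
  move=> T hT Tn0; have [r [/eqP rx Tr r0]] := x_sing T hT Tn0.
  by exists r; split=> //; rewrite /I rx.
apply: no_hom_injective => f w.
have [l [lE lI]] := hereditary_dual_basis quotient_injective
  (ann_submodule s) (Is _ (Ij w)).
suff [w' jw' fw'] : exists2 w', j w' = (\sum_(p <- l) p.1 * p.2 : R) & f w' = 0.
  by have -> : w = w' by apply: j_inj; rewrite jw'.
have {lE}lI p : p \in l -> I p.1 /\ p.2 *: s = 0.
  move=> /lI[ps pb]; split=> //; apply: satI => b bs.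
  have [d ->] := pb b bs.
  have := hI.2 d _ _ (Ij w) hI.1; rewrite addr0 -[_ *: _]/(d * _).
  by rewrite mulrC.
(* Each term p.1 * p.2 has p.1 in I and p.2 in m, so f kills it. *)
elim: l lI => [|p l IHl] lI; first by exists 0; rewrite ?big_nil raddf0.
have [|w' jw' fw'] := IHl; first by move=> q ql; apply: lI; rewrite inE ql orbT.
have [Ip ps] := lI p (mem_head _ _); have [u ju] := jI _ Ip.
exists (p.2 *: u + w').
  by rewrite big_cons linearP jw' ju -[p.2 *: _]/(p.2 * _) [p.2 * _]mulrC.
by rewrite linearP fw' addr0; exact: (ann_simple simpleS s_neq0).
Qed.

(** The map b |-> b y from the annihilator of s to t(M) is multiplication by an
    element z of t(M), which is injective; then y - z is killed by the
    annihilator of s and still lies outside t(M). *)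
Lemma socle_outside_trace (M : lmodType R) (x : M) :
  singular_element x -> ~ trace x ->
  exists y : M, ~ trace y /\ forall b : R, b *: s = 0 -> b *: y = 0.
Proof.
move=> x_sing /(socle_mod_trace x_sing)[y [Ny yt]].
have [X [j [j_inj tj jt]]] := submodule_exists (trace_submodule M).
have injX : injective_module X.
  apply: no_hom_injective => f u; apply: hom_trace.
  by apply: (trace_image j_inj).
have [|g gE] := injective_module_extend injX
    (G := fun (r : R^o) w => (r : R) *: s = 0 /\ j w = (r : R) *: y).
  split; first by rewrite !scale0r raddf0.
  - move=> a r w r' w' [rs jw] [r's jw']; rewrite linearP jw jw'.
    by rewrite !scalerDl -!scalerA rs r's scaler0 addr0.
  - by move=> w [_]; rewrite scale0r => jw; apply: j_inj; rewrite jw raddf0.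
exists (y - j (g (1 : R^o))); split=> [ty|b bs].
  apply: Ny; rewrite -(subrK (j (g (1 : R^o))) y) -[y - _]scale1r.
  by have [_ tD] := trace_submodule M; exact: tD.
have [w jw] := jt _ (yt b bs).
have := gE b w (conj bs jw).
have -> : b = b *: (1 : R^o) by rewrite -[RHS]/(b * 1) mulr1.
rewrite linearZ => gb; rewrite -[_ *: (1 : R^o)]/(b * 1) mulr1.
by rewrite scalerBr -linearZ gb jw subrr.
Qed.

(** With y outside t(M) and killed by the annihilator of s, s |-> y defines a
    map psi : S -> M. If N is in the subinjectivity domain of M, a nonzero
    phi : N -> S would give psi phi : N -> M whose extension to an injective E
    reaches y, forcing y into t(M). So Hom(N, S) = 0 and N is injective. *)
Lemma singular_indigent (M : lmodType R) :
  singular_module M -> ~ injective_module M -> indigent M.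
Proof.
move=> singM NinjM N; split=> [subN|injN]; last first.
  move=> K i i_inj f.
  have id_lin : linear (fun x : N => x) by [].
  have [g gE] := injN _ _ i i_inj (mk_linear id_lin).
  have fg_lin : linear (fun u => f (g u)) by move=> a u v; rewrite !linearP.
  by exists (mk_linear fg_lin) => x /=; rewrite gE.
have [x Nx] : exists x : M, ~ trace x.
  apply: contrapT => tM; apply: NinjM; apply: no_hom_injective => f u.
  by apply: hom_trace; apply: contrapT => Nu; apply: tM; exists u.
have [y [Ny ys]] := socle_outside_trace (singM x) Nx.
have [psi psiE] := simple_lift simpleS s_neq0 ys.
apply: no_hom_injective => phi n; apply: contrapT => /eqP phin.
have [r rE] := simple_cyclic simpleS phin s.
have [E [i [injE i_inj]]] := enough_injectives N.
have pp_lin : linear (fun u => psi (phi u)) by move=> a u v; rewrite !linearP.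
have [g gE] := subN _ i i_inj (mk_linear pp_lin).
apply: Ny; exists E, g, (i (r *: n)); split; first exact: injective_no_hom.
by rewrite gE /= linearZ /= rE.
Qed.

End IndigentSimple.

Theorem proposition22 (R : comPzRingType)
    (hns : nonsingular_ring R)
    (hV : ~ V_ring R)
    (hvn : ~ von_neumann_regular R) :
  (forall M : lmodType R, simple_module M -> indigent M \/ injective_module M)
  <->
  (forall M : lmodType R, singular_module M -> indigent M \/ injective_module M).
Proof.
split=> [simp M singM|sing M simpleM]; last first.
  by have [|/sing] := simple_injective_or_singular simpleM; [right|].
have [injM|NinjM] := pselect (injective_module M); [by right|left].
have [S simpleS NinjS] :
    exists2 S : lmodType R, simple_module S & ~ injective_module S.
  apply: contrapT => NS; apply: hV => S simpleS; apply: contrapT => NinjS.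
  by apply: NS; exists S.
have [[s s0] _] := simpleS.
have [indS|//] := simp S simpleS.
exact: singular_indigent (nonsingular_reduced hns) hvn simpleS s0 indS M singM NinjM.
Qed.
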